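(* If $\mathbf{g}\in\mathcal{G}$ and $\mathbf{y}\in P(Y_G)$ are such that $\Gamma(\mathbf{g})=\mathbf{g}+\mathbf{y}$, then $\Gamma^n(\mathbf{g})=\mathbf{g}+n\mathbf{y}$ for all $n\in\mathbb{N}$.
   Context: Let $\widetilde{\mathbb{Z}}=\mathbb{Z}\cup\{-\infty,+\infty\}$ and $X=\widetilde{\mathbb{Z}}^{\mathbb{Z}}$. Identify $\mathbb{Z}_5$ with $\{-2,-1,0,1,2\}$ and let $\oplus$ denote addition mod $5$ with representatives in this set. For $m\in\mathbb{Z}$ and $n\in\widetilde{\mathbb{Z}}$ let the clamped gradient $\delta_m(n)\in\{-2,\dots,2\}$ be $2$ if $n>m+1$, $-2$ if $n<m-1$, and $n-m$ otherwise. The sand automaton $\Gamma:X\to X$ is defined by $\Gamma(\mathbf{x})_i=x_i$ if $x_i=\pm\infty$, and, if $x_i\in\mathbb{Z}$, $$\Gamma(\mathbf{x})_i=x_i+\bigl(\delta_{x_i}(x_{i-1})\oplus\delta_{x_i}(x_{i+1})\bigr),$$ where the outer sum is taken in $\mathbb{Z}$. Let $\mathcal{G}=\{\mathbf{x}\in\mathbb{Z}^{\mathbb{Z}}:|x_i-x_{i-1}|\ge 2\text{ for all }i\in\mathbb{Z}\}$. For $\mathbf{x}\in\mathbb{Z}^{\mathbb{Z}}$ let $\Delta(\mathbf{x})_i=(\delta_{x_i}(x_{i-1}),\delta_{x_i}(x_{i+1}))$ be the pair of left and right gradients at $i$. For $\mathbf{g}\in\mathcal{G}$ every $\Delta(\mathbf{g})_i$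 lies in $\{(2,2),(-2,2),(2,-2),(-2,-2)\}$. Relabel these pairs as $(2,2)=-1$, $(-2,2)=0^-$, $(2,-2)=0^+$, $(-2,-2)=1$, and let $Y_G\subset\{0^-,0^+,1,-1\}^{\mathbb{Z}}$ be the image of $\Delta(\mathcal{G})$ under this relabelling. Let $P:Y_G\to\{-1,0,1\}^{\mathbb{Z}}$ be the map applying coordinatewise $p(0^-)=p(0^+)=0$, $p(1)=1$, $p(-1)=-1$. Addition of configurations and multiplication by $n$ are coordinatewise in $\mathbb{Z}$. *)

(* Defs.v *)
From HB Require Import structures.
From mathcomp Require Import all_boot all_order all_algebra.
From mathcomp Require Import boolp classical_sets constructive_ereal.
Set Implicit Arguments.
Unset Strict Implicit.
Unset Printing Implicit Defensive.
Import Order.TTheory GRing.Theory Num.Theory.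
Local Open Scope classical_set_scope.
Local Open Scope ring_scope.

Definition config : Type := int -> \bar int.

Definition emb (x : int -> int) : config := fun i => (x i)%:E.

(* Addition mod 5 with representatives in {-2, -1, 0, 1, 2}. *)
Definition add5 (a b : int) : int := ((a + b + 2) %% 5)%Z - 2.

(* The value 0 is never reached: an infinite n falls in one of the first two
   cases. *)
Definition delta (m : int) (n : \bar int) : int :=
  if ((m + 1)%:E < n)%E then 2
  else if (n < (m - 1)%:E)%E then -2
  else if n is k%:E then k - m else 0.

Definition Gamma (x : config) : config := fun i =>
  if x i is m%:E
  then (m + add5 (delta m (x (i - 1))) (delta m (x (i + 1))))%:E
  else x i.

Definition G : set (int -> int) :=
  [set x | forall i, 2 <= `|x i - x (i - 1)|].

Definition Delta (x : int -> int) : int -> int * int := fun i =>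
  (delta (x i) (x (i - 1))%:E, delta (x i) (x (i + 1))%:E).

Inductive symbol := ZeroMinus | ZeroPlus | One | MinusOne.

(* Only meaningful on the four pairs of [Delta_G]; the last branch is intended
   for (-2, -2). *)
Definition relabel (d : int * int) : symbol :=
  if d == (2, 2) then MinusOne
  else if d == (-2, 2) then ZeroMinus
  else if d == (2, -2) then ZeroPlus
  else One.

Lemma Delta_G (g : int -> int) (i : int) : G g ->
  Delta g i \in [:: (2, 2); (-2, 2); (2, -2); (-2, -2)].
Proof.
have H (m n : int) : 2 <= `|m - n| ->
    (delta m n%:E == 2) || (delta m n%:E == -2).
  move=> mn; rewrite /delta !lte_fin.
  case: ltP => // le1; case: ltP => // le2.
  exfalso; move: mn; apply/negP; rewrite -ltNge.
  apply: (@le_lt_trans _ _ (1 : int)) => //.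
  by rewrite distrC ler_distl le2 le1.
move=> Gg; rewrite /Delta.
have /orP[/eqP-> | /eqP->] := H _ _ (Gg i);
have := Gg (i + 1); rewrite addrK distrC => /H /orP[/eqP-> | /eqP->];
by [].
Qed.

Definition Y_G : set (int -> symbol) :=
  (fun d => relabel \o d) @` (Delta @` G).

Definition p (s : symbol) : int :=
  match s with
  | ZeroMinus | ZeroPlus => 0
  | One => 1
  | MinusOne => -1
  end.

Definition P (z : int -> symbol) : int -> int := p \o z.

(* Main.v *)
Require Import Defs.
From mathcomp Require Import all_boot all_order all_algebra.
From mathcomp Require Import boolp classical_sets constructive_ereal.
From mathcomp Require Import zify.
Import Order.TTheory GRing.Theory Num.Theory.
Local Open Scope classical_set_scope.
Local Open Scope ring_scope.

(** On a configuration of [G] every gradient is 2 or -2, and 2 + 2 = -1,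
    -2 - 2 = 1, 2 - 2 = 0 modulo 5: the automaton raises the strict local
    maxima by 1, lowers the strict local minima by 1 and leaves every other
    cell in place.  Of two adjacent cells, the lower one is not a local maximum
    and the higher one is not a local minimum, so the lower one cannot rise and
    the higher one cannot sink ([step_adjacent]).  Hence moving along the first
    increment, any number of times, only widens the gaps and keeps their signs
    ([delta_push]): all the gradients stay what they were, and so does the
    increment, which depends on the gradients alone.  The increment [y] is
    determined by the equation for the first iterate. *)

(** What the automaton adds to a finite configuration: [Gamma (emb x)] is
    [emb (x + step x)] by computation. *)
Definition step (x : int -> int) (i : int) : int :=
  add5 (delta (x i) (x (i - 1))%:E) (delta (x i) (x (i + 1))%:E).

Definition adjacent (i j : int) : bool := (j == i - 1) || (j == i + 1).

Lemma delta_far {m k : int} :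
  2 <= `|m - k| -> delta m k%:E = if m < k then 2 else -2.
Proof.
move=> far; rewrite /delta !lte_fin.
by case: ifP => ?; [|case: ifP => ?]; case: ifP => ? //; exfalso; lia.
Qed.

Lemma G_adjacent {x : int -> int} {i j : int} :
  G x -> adjacent i j -> 2 <= `|x i - x j|.
Proof.
move=> Gx /orP[] /eqP->; first exact: Gx.
by have := Gx (i + 1); rewrite addrK distrC.
Qed.

(** A cell with a higher neighbour is not a local maximum, and one with a lower
    neighbour is not a local minimum. *)
Lemma step_adjacent {x : int -> int} {i j : int} :
  G x -> adjacent i j ->
  if x i < x j then step x i <= 0 else 0 <= step x i.
Proof.
move=> Gx; have adjl : adjacent i (i - 1) by rewrite /adjacent eqxx.
have adjr : adjacent i (i + 1) by rewrite /adjacent eqxx orbT.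
rewrite /step (delta_far (G_adjacent Gx adjl)) (delta_far (G_adjacent Gx adjr)).
by case/orP => /eqP->; case: (x i < x (i - 1)); case: (x i < x (i + 1)).
Qed.

(** Adjacent cells are pushed apart, so that the gap between them keeps its
    sign and remains at least 2. *)
Lemma delta_push (x : int -> int) (n : nat) (i j : int) :
  G x -> adjacent i j ->
  delta (x i + n%:Z * step x i) (x j + n%:Z * step x j)%:E
    = delta (x i) (x j)%:E.
Proof.
move=> Gx adj; have adj' : adjacent j i by move: adj; rewrite /adjacent; lia.
have far := G_adjacent Gx adj.
have := step_adjacent Gx adj; have := step_adjacent Gx adj'.
set a := step x i; set b := step x j.
rewrite (delta_far far); case: (ltP (x i) (x j)) => [lt_ij|le_ji].
  have -> : (x j < x i) = false by lia.
  move=> b_ge0 a_le0.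
  have nb : 0 <= n%:Z * b by apply: mulr_ge0.
  have na : n%:Z * a <= 0 by apply: mulr_ge0_le0.
  rewrite delta_far; last by lia.
  by have -> : x i + n%:Z * a < x j + n%:Z * b by lia.
have -> : x j < x i by lia.
move=> b_le0 a_ge0.
have nb : n%:Z * b <= 0 by apply: mulr_ge0_le0.
have na : 0 <= n%:Z * a by apply: mulr_ge0.
rewrite delta_far; last by lia.
by have -> : (x i + n%:Z * a < x j + n%:Z * b) = false by lia.
Qed.

Lemma step_push (x : int -> int) (n : nat) :
  G x -> step (fun i => x i + n%:Z * step x i) = step x.
Proof.
move=> Gx; apply/funext => i; rewrite {1}/step.
by rewrite !delta_push // /adjacent eqxx ?orbT.
Qed.

Theorem proposition3p5 (g y : int -> int) :
  G g -> (P @` Y_G) y ->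
  Gamma (emb g) = emb (fun i => g i + y i) ->
  forall n : nat, iter n Gamma (emb g) = emb (fun i => g i + n%:Z * y i).
Proof.
move=> Gg _ Gamma_g.
have -> : y = step g.
  by apply/funext => i; have [/addrI] := congr1 (fun c => c i) Gamma_g.
elim=> [|n IHn]; first by apply/funext => i; rewrite /emb mul0r addr0.
rewrite iterS IHn; set x := fun i => g i + n%:Z * step g i.
have -> : Gamma (emb x) = emb (fun i => x i + step x i) by [].
rewrite step_push //; apply/funext => i; congr (_%:E).
by rewrite /x -addrA intS mulrDl mul1r [step g i + _]addrC.
Qed.
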